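(* Let $A\in\mathbb{R}^{m\times n}$ have nonzero rows and let $b\in\mathbb{R}^m$ be such that the linear system $Ax=b$ is consistent. Let $x^0\in\mathbb{R}^n$ be an arbitrary initial vector and let $x^0_*:=A^\dagger b+(I-A^\dagger A)x^0$. Let $\{x^k\}_{k\geq 0}$ be the sequence generated from $x^0$ by the random reshuffling Kaczmarz (RRK) method, with $\pi_k$ the permutation of $[m]$ used in the $k$-th epoch. Then for every $k\geq 0$ (and every realization of the random permutations), $$\|x^{k+1}-x^0_*\|_2\leq \|T_{\pi_k}A^\dagger A\|_2\cdot\|x^k-x^0_*\|_2,$$ and $\|T_{\pi_k}A^\dagger A\|_2<1$.
   Context: Notation: $[m]=\{1,\dots,m\}$; $A^\dagger$ is the Moore-Penrose pseudoinverse of $A$; $\|\cdot\|_2$ is the Euclidean norm for vectors and the spectral norm for matrices; $a_i\in\mathbb{R}^n$ is the $i$-th row of $A$ written as a column vector, and $b_i$ is the $i$-th entry of $b$. RRK method: given $x^0\in\mathbb{R}^n$, for $k=0,1,2,\dots$ set $x^k_0:=x^k$, generate a random permutation $\pi_k=(\pi_{k,1},\dots,\pi_{k,m})$ of $[m]$, and for $i=1,\dots,m$ set $$x^k_i:=x^k_{i-1}-\frac{\langle a_{\pi_{k,i}},x^k_{i-1}\rangle-b_{\pi_{k,i}}}{\|a_{\pi_{k,i}}\|_2^2}\,a_{\pi_{k,i}};$$ then set $x^{k+1}:=x^k_m$. Iteration matrix: for a permutation $\pi=(\pi_1,\dots,\pi_m)$ of $[m]$, $$T_\pi:=\left(I-\frac{a_{\pi_m}a_{\pi_m}^\top}{\|a_{\pi_m}\|_2^2}\right)\cdots\left(I-\frac{a_{\pi_1}a_{\pi_1}^\top}{\|a_{\pi_1}\|_2^2}\right).$$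 *)

(* Defs.v *)
From mathcomp Require Export all_boot all_order all_fingroup all_algebra.
From mathcomp Require Export boolp classical_sets reals.

Set Implicit Arguments.
Unset Strict Implicit.
Unset Printing Implicit Defensive.

Export Order.TTheory GRing.Theory Num.Theory.
Global Open Scope ring_scope.

Definition dotv (R : realType) (n : nat) (u v : 'cV[R]_n) : R :=
  \sum_(i < n) u i 0 * v i 0.

(* MathComp-Analysis equips matrices with the maximum norm `|_|, hence the
   separate Euclidean and spectral norms. *)
Definition norm2 (R : realType) (n : nat) (u : 'cV[R]_n) : R :=
  Num.sqrt (dotv u u).

(* The operator norm induced by the Euclidean norms. *)
Definition spectral_norm (R : realType) (m n : nat) (M : 'M[R]_(m, n)) : R :=
  sup [set norm2 (M *m u) | u in [set u : 'cV[R]_n | norm2 u <= 1]].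

(* The four Penrose equations. *)
Definition is_pinv (R : realType) (m n : nat)
    (A : 'M[R]_(m, n)) (X : 'M[R]_(n, m)) : Prop :=
  [/\ A *m X *m A = A,
      X *m A *m X = X,
      (A *m X)^T = A *m X
    & (X *m A)^T = X *m A].

(* The default value 0 is never used: see [pinvP] and [is_pinv_unique]. *)
Definition pinv (R : realType) (m n : nat) (A : 'M[R]_(m, n)) : 'M[R]_(n, m) :=
  xget 0 [set X | is_pinv A X].

Definition rowv (R : realType) (m n : nat) (A : 'M[R]_(m, n)) (i : 'I_m) :
    'cV[R]_n :=
  (row i A)^T.

Definition kaczmarz_step (R : realType) (m n : nat)
    (A : 'M[R]_(m, n)) (b : 'cV[R]_m) (i : 'I_m) (x : 'cV[R]_n) : 'cV[R]_n :=
  x - ((dotv (rowv A i) x - b i 0) / norm2 (rowv A i) ^+ 2) *: rowv A i.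

(* The rows are used in the order s 0, s 1, ..., s (m - 1). *)
Definition rrk_epoch (R : realType) (m n : nat)
    (A : 'M[R]_(m, n)) (b : 'cV[R]_m) (s : 'S_m) (x : 'cV[R]_n) : 'cV[R]_n :=
  foldl (fun y i => kaczmarz_step A b (s i) y) x (enum 'I_m).

(* [pi k] is the permutation drawn in epoch [k]. *)
Fixpoint rrk (R : realType) (m n : nat) (A : 'M[R]_(m, n)) (b : 'cV[R]_m)
    (pi : nat -> 'S_m) (x0 : 'cV[R]_n) (k : nat) : 'cV[R]_n :=
  if k is k'.+1 then rrk_epoch A b (pi k') (rrk A b pi x0 k') else x0.

Definition kaczmarz_proj (R : realType) (n : nat) (a : 'cV[R]_n) : 'M[R]_n :=
  1%:M - (norm2 a ^+ 2)^-1 *: (a *m a^T).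

(* The product is not commutative: the factor of s 0 is the rightmost one. *)
Definition iter_mx (R : realType) (m n : nat)
    (A : 'M[R]_(m, n)) (s : 'S_m) : 'M[R]_n :=
  \big[mulmx/1%:M]_(i < m) kaczmarz_proj (rowv A (s (rev_ord i))).

Lemma dotvE (R : realType) (n : nat) (u v : 'cV[R]_n) :
  dotv u v = (u^T *m v) 0 0.
Proof. by rewrite mxE; apply: eq_bigr => i _; rewrite mxE. Qed.

Lemma dotv_ge0 (R : realType) (n : nat) (u : 'cV[R]_n) : 0 <= dotv u u.
Proof. by apply: sumr_ge0 => i _; rewrite -expr2 sqr_ge0. Qed.

Lemma dotv_eq0 (R : realType) (n : nat) (u : 'cV[R]_n) :
  dotv u u = 0 -> u = 0.
Proof.
move=> u0; apply/matrixP => i j; rewrite ord1 mxE; apply/eqP.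
rewrite -sqrf_eq0 expr2; apply/eqP; move: i (erefl true).
by apply: psumr_eq0P u0 => i _; rewrite -expr2 sqr_ge0.
Qed.

(* The supremum defining the spectral norm is a genuine one. *)
Lemma has_sup_spectral_norm (R : realType) (m n : nat) (M : 'M[R]_(m, n)) :
  has_sup [set norm2 (M *m u) | u in [set u : 'cV[R]_n | norm2 u <= 1]].
Proof.
split.
  exists (norm2 (M *m 0)); exists 0 => //=.
  by rewrite /norm2 /dotv big1 ?sqrtr0 // => i _; rewrite mxE mul0r.
exists (Num.sqrt (\sum_(i < m) (\sum_(j < n) `|M i j|) ^+ 2)) => _ [u /= u1 <-].
have {}u1 j : `|u j 0| <= 1.
  have : norm2 u ^+ 2 <= 1 by rewrite expr_le1 ?sqrtr_ge0.
  rewrite sqr_sqrtr ?dotv_ge0// /dotv (bigD1 j)//= => le1.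
  rewrite -(@expr_le1 _ 2)// real_normK ?num_real// expr2.
  apply: le_trans le1; rewrite lerDl.
  by apply: sumr_ge0 => i _; rewrite -expr2 sqr_ge0.
apply: ler_wsqrtr; apply: ler_sum => i _.
rewrite -expr2 -real_normK ?num_real// ler_sqr ?nnegrE ?sumr_ge0// mxE.
apply: le_trans (ler_norm_sum _ _ _) _; apply: ler_sum => j _.
by rewrite normrM ler_piMr.
Qed.

Lemma is_pinv_unique (R : realType) (m n : nat) (A : 'M[R]_(m, n)) X Y :
  is_pinv A X -> is_pinv A Y -> X = Y.
Proof.
case=> AXA XAX AXs XAs [AYA YAY AYs YAs].
have eAX : A *m X = A *m Y.
  by rewrite -[LHS]AXs -{1}AYA -mulmxA trmx_mul AXs AYs mulmxA AXA.
have eXA : X *m A = Y *m A.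
  by rewrite -[LHS]XAs -{1}AYA -mulmxA mulmxA trmx_mul XAs YAs -mulmxA mulmxA
    -mulmxA (mulmxA A) AXA.
by rewrite -XAX -mulmxA eAX mulmxA eXA YAY.
Qed.

Lemma row_free_gram_unit (R : realType) (r n : nat) (F : 'M[R]_(r, n)) :
  row_free F -> F *m F^T \in unitmx.
Proof.
move=> Ffree; rewrite -row_free_unit.
rewrite -kermx_eq0; apply/rowV0P => v /sub_kermxP vFF.
apply/eqP; rewrite -(mulmx_free_eq0 _ Ffree); apply/eqP/trmx_inj.
rewrite trmx0; apply: dotv_eq0.
by rewrite dotvE trmxK trmx_mul mulmxA -(mulmxA v) vFF mul0mx mxE.
Qed.

Lemma is_pinv_exists (R : realType) (m n : nat) (A : 'M[R]_(m, n)) :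
  exists X, is_pinv A X.
Proof.
have [r [C [F [AE CU FU]]]] : exists r (C : 'M[R]_(m, r)) (F : 'M[R]_(r, n)),
    [/\ A = C *m F, C^T *m C \in unitmx & F *m F^T \in unitmx].
  exists (\rank A), (col_base A), (row_base A); split.
  - by rewrite mulmx_base.
  - rewrite -{2}[col_base A]trmxK; apply: row_free_gram_unit.
    by rewrite /row_free mxrank_tr; exact: col_base_full.
  - exact/row_free_gram_unit/row_base_free.
pose G := invmx (F *m F^T); pose H := invmx (C^T *m C).
have Gs : G^T = G by rewrite trmx_inv trmx_mul trmxK.
have Hs : H^T = H by rewrite trmx_inv trmx_mul trmxK.
pose X := F^T *m G *m (H *m C^T).
have AX : A *m X = C *m H *m C^T.
  by rewrite AE /X !mulmxA -(mulmxA C F) -(mulmxA C _ G) mulmxV// mulmx1.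
have XA : X *m A = F^T *m G *m F.
  by rewrite AE /X !mulmxA -(mulmxA _ C^T C) -(mulmxA _ H) mulVmx// mulmx1.
exists X; split.
- by rewrite AX AE !mulmxA -(mulmxA _ C^T C) -(mulmxA C H) mulVmx// mulmx1.
- by rewrite XA /X !mulmxA -(mulmxA _ F F^T) -(mulmxA _ _ G) mulmxV// mulmx1.
- by rewrite AX !trmx_mul trmxK Hs mulmxA.
- by rewrite XA !trmx_mul trmxK Gs mulmxA.
Qed.

Lemma pinvP (R : realType) (m n : nat) (A : 'M[R]_(m, n)) : is_pinv A (pinv A).
Proof. by have [X AX] := is_pinv_exists A; apply: (@xgetPex _ 0); exists X. Qed.

(* Main.v *)
Require Import Defs.
From mathcomp Require Import ring lra.

Set Implicit Arguments.
Unset Strict Implicit.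
Unset Printing Implicit Defensive.

(** Let P be the matrix pinv A *m A, the orthogonal projector onto the row
space of A, and T the iteration matrix of an epoch.  The vector x* solves
A x = b, so a Kaczmarz step acts on the error x - x* as the orthogonal
projector onto the complement of the row it uses, and an epoch acts on it as T.  The initial
error lies in the range of P, which every step preserves because P fixes the
rows of A; so T acts on the error as T P does, which gives the first bound.

The strict bound comes from an explicit estimate: the energy |v|^2 - |T v|^2
lost in a sweep is the sum of the squared inner products of the normalized
rows with the successive iterates.  Replacing these iterates by v itself, one
row at a time, shows that each <a_i, v>^2, hence |A v|^2, is at most a
constant times the energy lost ([sweep_energy], [pinv_sweep_energy]).  For
v = P u one has v = pinv A *m (A *m v), so that |v|^2 <= K (|v|^2 - |T v|^2),
that is, |T v|^2 <= (1 - 1/K) |v|^2 with a constant K > 0 that does not depend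
on u; finally |P u| <= |u|. *)

(** * Euclidean and spectral norms *)

Section Norms.
Context {R : realType}.
Implicit Types m n : nat.

Lemma dotvC n (u v : 'cV[R]_n) : dotv u v = dotv v u.
Proof. by apply: eq_bigr => i _; rewrite mulrC. Qed.

Lemma dotvDr n (u v w : 'cV[R]_n) : dotv u (v + w) = dotv u v + dotv u w.
Proof. by rewrite !dotvE mulmxDr mxE. Qed.

Lemma dotvZr n c (u v : 'cV[R]_n) : dotv u (c *: v) = c * dotv u v.
Proof. by rewrite !dotvE -scalemxAr mxE. Qed.

Lemma dotvDl n (u v w : 'cV[R]_n) : dotv (u + v) w = dotv u w + dotv v w.
Proof. by rewrite dotvC dotvDr !(dotvC w). Qed.

Lemma dotvZl n c (u v : 'cV[R]_n) : dotv (c *: u) v = c * dotv u v.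
Proof. by rewrite dotvC dotvZr (dotvC v). Qed.

Lemma sqr_norm2 n (u : 'cV[R]_n) : norm2 u ^+ 2 = dotv u u.
Proof. by rewrite sqr_sqrtr ?dotv_ge0. Qed.

Lemma norm2_ge0 n (u : 'cV[R]_n) : 0 <= norm2 u.
Proof. exact: sqrtr_ge0. Qed.

Lemma norm2Z n c (u : 'cV[R]_n) : norm2 (c *: u) = `|c| * norm2 u.
Proof.
by rewrite /norm2 dotvZl dotvZr mulrA -expr2 sqrtrM ?sqr_ge0// sqrtr_sqr.
Qed.

Lemma norm2_eq0 n (u : 'cV[R]_n) : norm2 u = 0 -> u = 0.
Proof. by move=> u0; apply: dotv_eq0; rewrite -sqr_norm2 u0 expr0n. Qed.

Lemma norm2_mulmx_le m n (M : 'M[R]_(m, n)) (u : 'cV[R]_n) :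
  norm2 (M *m u) <= spectral_norm M * norm2 u.
Proof.
have [u0|u_neq0] := eqVneq (norm2 u) 0.
  by rewrite u0 (norm2_eq0 u0) mulmx0 mulr0 -(scale0r 0) norm2Z normr0 mul0r.
have u_gt0 : 0 < norm2 u by rewrite lt_def u_neq0 norm2_ge0.
rewrite -ler_pdivrMr//.
have -> : norm2 (M *m u) / norm2 u = norm2 (M *m ((norm2 u)^-1 *: u)).
  by rewrite -scalemxAr norm2Z ger0_norm ?invr_ge0 ?norm2_ge0// mulrC.
apply: (ub_le_sup (has_sup_spectral_norm M).2).
exists ((norm2 u)^-1 *: u) => //=.
by rewrite norm2Z ger0_norm ?invr_ge0 ?norm2_ge0// mulVf.
Qed.

Lemma spectral_norm_le m n (M : 'M[R]_(m, n)) c :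
  (forall u, norm2 u <= 1 -> norm2 (M *m u) <= c) -> spectral_norm M <= c.
Proof.
move=> Mc; apply: ge_sup; first exact: (has_sup_spectral_norm M).1.
by move=> _ [u /= u1 <-]; exact: Mc.
Qed.

Lemma dotv_mulmx_sum m n (A : 'M[R]_(m, n)) (v : 'cV[R]_n) :
  dotv (A *m v) (A *m v) = \sum_i dotv (rowv A i) v ^+ 2.
Proof.
apply: eq_bigr => i _; rewrite expr2 mxE; congr (_ * _);
  by apply: eq_bigr => j _; rewrite !mxE.
Qed.

(** The vectors P u and u - P u are orthogonal, and their sum is u. *)
Lemma norm2_orthoproj_le n (P : 'M[R]_n) (u : 'cV[R]_n) :
  P^T = P -> P *m P = P -> norm2 (P *m u) <= norm2 u.
Proof.
move=> Ps Pi; apply: ler_wsqrtr.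
have e : dotv (P *m u) (P *m u) = dotv (P *m u) u.
  by rewrite !dotvE trmx_mul Ps -!mulmxA (mulmxA P) Pi.
have := dotv_ge0 (u - P *m u).
rewrite -scaleN1r !(dotvDl, dotvDr, dotvZl, dotvZr) (dotvC u (P *m u)) e; lra.
Qed.

End Norms.

(** * Energy lost in a sweep of projections *)

Section Sweep.
Context {R : realType} {n : nat}.
Implicit Types (a v : 'cV[R]_n) (s : seq 'cV[R]_n).

Definition sweep s v : 'cV[R]_n :=
  foldl (fun y a => kaczmarz_proj a *m y) v s.

Lemma kaczmarz_projE a v :
  kaczmarz_proj a *m v = v - (dotv a v / dotv a a) *: a.
Proof.
rewrite /kaczmarz_proj sqr_norm2 mulmxBl mul1mx -scalemxAl -mulmxA.
rewrite [a^T *m v]mx11_scalar -dotvE mul_mx_scalar scalerA.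
by rewrite [_^-1 * _]mulrC.
Qed.

Lemma kaczmarz_proj_energy a v : a != 0 ->
  dotv v v = dotv (kaczmarz_proj a *m v) (kaczmarz_proj a *m v)
             + dotv a v ^+ 2 / dotv a a.
Proof.
move=> a0; have aa0 : dotv a a != 0.
  by apply: contra_neq a0; exact: dotv_eq0.
rewrite kaczmarz_projE -scaleNr !(dotvDl, dotvDr, dotvZl, dotvZr) (dotvC v a).
by field.
Qed.

Lemma sweep_energy_le s v : {in s, forall a, a != 0} ->
  dotv (sweep s v) (sweep s v) <= dotv v v.
Proof.
elim: s v => //= a s IH v s0.
have a0 : a != 0 by apply: s0; rewrite mem_head.
apply: le_trans (IH _ _) _ => [c cs|]; first by apply: s0; rewrite inE cs orbT.
by rewrite (kaczmarz_proj_energy v a0) lerDl divr_ge0 ?sqr_ge0 ?dotv_ge0.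
Qed.

(** The first projection moves v only along its own vector c, by an amount
that the energy lost in that step controls; so passing from the projected
vector back to v costs each later inner product at most a multiple of that
energy, and induction on the sweep applies. *)
Lemma sweep_energy s a : {in s, forall c, c != 0} -> a \in s ->
  exists2 C, 0 <= C & forall v,
    dotv a v ^+ 2 <= C * (dotv v v - dotv (sweep s v) (sweep s v)).
Proof.
elim: s => //= c s IH s0.
have c0 : c != 0 by apply: s0; rewrite mem_head.
have {}s0 : {in s, forall d, d != 0}.
  by move=> d ds; apply: s0; rewrite inE ds orbT.
have cc : 0 < dotv c c.
  by rewrite lt_def dotv_ge0 andbT; apply: contra_neq c0; exact: dotv_eq0.
rewrite inE => /predU1P[->|/(IH s0)[C C0 HC]].
  exists (dotv c c); rewrite ?dotv_ge0// => v.
  rewrite mulrC -ler_pdivrMr// {1}(kaczmarz_proj_energy v c0).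
  by rewrite addrAC lerDr subr_ge0 sweep_energy_le.
(* The factors 2 come from (x + y)^2 <= 2 x^2 + 2 y^2, used with <a, v> = <a, w> + t <a, c>,
   where v = w + t c. *)
exists (2 * C + 2 * (dotv a c ^+ 2 / dotv c c)).
  by rewrite addr_ge0// mulr_ge0// divr_ge0 ?sqr_ge0 ?dotv_ge0.
move=> v; set w := kaczmarz_proj c *m v.
have aw : dotv a v = dotv a w + dotv c v / dotv c c * dotv a c.
  by rewrite /w kaczmarz_projE -scaleNr dotvDr dotvZr; ring.
set L := dotv w w - dotv (sweep s w) (sweep s w).
have L0 : 0 <= L by rewrite subr_ge0 sweep_energy_le.
set E := dotv c v ^+ 2 / dotv c c.
have E0 : 0 <= E by rewrite divr_ge0 ?sqr_ge0 ?dotv_ge0.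
set B := dotv a c ^+ 2 / dotv c c.
have B0 : 0 <= B by rewrite divr_ge0 ?sqr_ge0 ?dotv_ge0.
have -> : dotv v v - dotv (sweep s w) (sweep s w) = L + E.
  by rewrite (kaczmarz_proj_energy v c0) -/w -/E /L; ring.
have EB : E * B = (dotv c v / dotv c c * dotv a c) ^+ 2.
  by rewrite /E /B; field; rewrite gt_eqF.
have := HC w; rewrite -/L aw => HL.
have := sqr_ge0 (dotv a w - dotv c v / dotv c c * dotv a c).
have CE : 0 <= C * E by exact: mulr_ge0.
have BL : 0 <= B * L by exact: mulr_ge0.
nra.
Qed.

End Sweep.

(** * The projector onto the row space *)

Section RowSpace.
Context {R : realType} {m n : nat}.
Implicit Types (A : 'M[R]_(m, n)) (v : 'cV[R]_n).

Lemma mulmx_rowv A i v : (A *m v) i 0 = dotv (rowv A i) v.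
Proof. by rewrite mxE; apply: eq_bigr => j _; rewrite !mxE. Qed.

Lemma pinv_rowv A i : pinv A *m A *m rowv A i = rowv A i.
Proof.
have [AXA _ _ XAs] := pinvP A.
by rewrite -[pinv A *m A]XAs /rowv -trmx_mul -row_mul mulmxA AXA.
Qed.

Lemma pinv_sweep A (r : seq 'I_m) v : pinv A *m A *m v = v ->
  pinv A *m A *m sweep [seq rowv A i | i <- r] v
    = sweep [seq rowv A i | i <- r] v.
Proof.
elim: r v => //= i r IH v Pv; apply: IH.
by rewrite kaczmarz_projE mulmxBr Pv -scalemxAr pinv_rowv.
Qed.

(** On the row space v = pinv A *m (A *m v), so the inner products of v with
the rows, which the energy lost controls, determine the size of v. *)
Lemma pinv_sweep_energy A (r : seq 'I_m) :
  (forall i, rowv A i != 0) -> (forall i, i \in r) ->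
  exists2 K, 0 <= K & forall v, pinv A *m A *m v = v ->
    let Tv := sweep [seq rowv A i | i <- r] v in
    dotv v v <= K * (dotv v v - dotv Tv Tv).
Proof.
move=> A0 r_all.
have /fin_all_exists[C HC] : forall i, exists C, 0 <= C /\ forall v,
    dotv (rowv A i) v ^+ 2 <= C *
      (dotv v v - dotv (sweep [seq rowv A i | i <- r] v)
                       (sweep [seq rowv A i | i <- r] v)).
  move=> i; have [||C C0 HC] :=
    @sweep_energy R n [seq rowv A i | i <- r] (rowv A i).
  - by move=> _ /mapP[j _ ->].
  - exact: map_f.
  by exists C.
exists (spectral_norm (pinv A) ^+ 2 * \sum_i C i).
  by rewrite mulr_ge0 ?sqr_ge0// sumr_ge0// => i _; case: (HC i).
move=> v Pv /=; set Tv := sweep _ v.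
have Av : dotv (A *m v) (A *m v) <= (\sum_i C i) * (dotv v v - dotv Tv Tv).
  rewrite dotv_mulmx_sum mulr_suml; apply: ler_sum => i _.
  by case: (HC i).
apply: (@le_trans _ _ (spectral_norm (pinv A) ^+ 2 * dotv (A *m v) (A *m v))).
  rewrite -!sqr_norm2 -exprMn -{1}Pv -mulmxA.
  have le := norm2_mulmx_le (pinv A) (A *m v).
  by rewrite lerXn2r// nnegrE ?(le_trans _ le) ?norm2_ge0.
by rewrite -[leRHS]mulrA ler_wpM2l ?sqr_ge0.
Qed.

End RowSpace.

(** * The iteration matrix and the error of an epoch *)

Section Epoch.
Context {R : realType} {m n : nat}.
Implicit Types (A : 'M[R]_(m, n)) (s : 'S_m) (v : 'cV[R]_n).

Lemma rev_enum_ord : rev (enum 'I_m) = [seq rev_ord i | i <- enum 'I_m].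
Proof.
case: m => [|p]; first by rewrite [enum _]size0nil ?size_enum_ord.
apply: (@eq_from_nth _ ord0) => [|i]; rewrite size_rev size_enum_ord.
  by rewrite size_map size_enum_ord.
move=> ip; have sip : (p.+1 - i.+1 < p.+1)%N by rewrite ltn_subrL.
rewrite nth_rev ?size_enum_ord// (nth_map ord0) ?size_enum_ord//.
by apply: val_inj; rewrite /= !nth_enum_ord.
Qed.

Lemma iter_mx_sweep A s v :
  iter_mx A s *m v = sweep [seq rowv A i | i <- [seq s i | i <- enum 'I_m]] v.
Proof.
have big_mulmx (F : 'I_m -> 'M[R]_n) r : (\big[mulmx/1%:M]_(i <- r) F i) *m v
    = foldr (fun i y => F i *m y) v r.
  elim: r => [|i r IH]; first by rewrite big_nil mul1mx.
  by rewrite big_cons -mulmxA IH.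
have -> : iter_mx A s
    = \big[mulmx/1%:M]_(i <- rev (enum 'I_m)) kaczmarz_proj (rowv A (s i)).
  by rewrite /iter_mx rev_enum_ord big_map enumT [index_enum _]unlock.
rewrite big_mulmx.
rewrite -(foldl_rev (fun y i => kaczmarz_proj (rowv A (s i)) *m y)) revK.
by elim: (enum _) {big_mulmx}v => //=.
Qed.

(** The energy bound turns |v|^2 <= K (|v|^2 - |T v|^2) into
|T v|^2 <= (1 - 1/(K + 1)) |v|^2, uniformly on the row space; K + 1 replaces K
because K can vanish, for instance when A is an empty matrix. *)
Lemma spectral_norm_iter_lt1 A s : (forall i, rowv A i != 0) ->
  spectral_norm (iter_mx A s *m pinv A *m A) < 1.
Proof.
move=> A0.
have [|K K0 HK] := @pinv_sweep_energy R m n A [seq s i | i <- enum 'I_m] A0.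
  by move=> i; rewrite -[i](permKV s) map_f// mem_enum.
have [_ XAX _ XAs] := pinvP A.
have PP : pinv A *m A *m (pinv A *m A) = pinv A *m A by rewrite mulmxA XAX.
have K1 : 0 < K + 1 by lra.
apply: (@le_lt_trans _ _ (Num.sqrt (1 - (K + 1)^-1))); last first.
  rewrite -[ltRHS]sqrtr1 ltr_sqrt ?ltr01//.
  by rewrite ltrBlDr ltrDl invr_gt0.
apply: spectral_norm_le => u u1; apply: ler_wsqrtr.
rewrite -!mulmxA (mulmxA (pinv A)) iter_mx_sweep.
set v := pinv A *m A *m u; set Tv := sweep _ v.
have vv : dotv v v <= 1.
  rewrite -sqr_norm2 expr_le1 ?norm2_ge0//.
  by apply: le_trans u1; exact: norm2_orthoproj_le.
have := HK v; rewrite -/Tv /v mulmxA PP => /(_ erefl); rewrite -/v => /= {}HK.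
have -> : 1 - (K + 1)^-1 = K / (K + 1) by field; rewrite gt_eqF.
rewrite ler_pdivlMr//.
have Tvv : dotv Tv Tv <= dotv v v.
  by apply: sweep_energy_le => _ /mapP[i _ ->].
have := ler_wpM2l K0 vv; lra.
Qed.

Lemma rrk_epoch_error A b s x y : A *m y = b ->
  rrk_epoch A b s x - y
    = sweep [seq rowv A i | i <- [seq s i | i <- enum 'I_m]] (x - y).
Proof.
move=> Ay; rewrite /rrk_epoch; elim: (enum _) x => //= i r IH x.
rewrite IH; congr sweep.
rewrite kaczmarz_projE /kaczmarz_step sqr_norm2 -Ay mulmx_rowv.
by rewrite -[in RHS]scaleN1r dotvDr dotvZr mulN1r scaleN1r addrAC.
Qed.

End Epoch.

Theorem theorem3p2 (R : realType) (m n : nat)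
    (A : 'M[R]_(m, n)) (b : 'cV[R]_m)
    (A_rows : forall i : 'I_m, rowv A i != 0)
    (consistent : exists x : 'cV[R]_n, A *m x = b)
    (x0 : 'cV[R]_n) (pi : nat -> 'S_m) (k : nat) :
  let xstar := pinv A *m b + (1%:M - pinv A *m A) *m x0 in
  let x := rrk A b pi x0 in
  norm2 (x k.+1 - xstar)
    <= spectral_norm (iter_mx A (pi k) *m pinv A *m A) * norm2 (x k - xstar)
  /\ spectral_norm (iter_mx A (pi k) *m pinv A *m A) < 1.
Proof.
move=> xstar x; split; last exact: spectral_norm_iter_lt1.
have [AXA XAX _ _] := pinvP A.
have Axstar : A *m xstar = b.
  rewrite /xstar; case: consistent => z <-; rewrite mulmxDr !mulmxA AXA mulmxBr mulmx1.
  by rewrite mulmxA AXA subrr mul0mx addr0.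
have Px j : pinv A *m A *m (x j - xstar) = x j - xstar.
  elim: j => [|j IH].
    have -> : x 0 - xstar = pinv A *m (A *m x0 - b).
      by rewrite /x/= /xstar mulmxBl mul1mx mulmxBr mulmxA opprD opprB addrCA
        subrKC addrC.
    by rewrite mulmxA XAX.
  by rewrite /x/= rrk_epoch_error//; exact: pinv_sweep.
apply: le_trans (norm2_mulmx_le _ _).
by rewrite -!mulmxA (mulmxA (pinv A)) Px iter_mx_sweep -(rrk_epoch_error _ _ Axstar).
Qed.
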